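(* Let $q\ge0$ with $q\ne1$, and let $u$ be a rate function. (1) The stationary distribution corresponding to $u$ in the homogeneous PALRMP with parameter $q$ is factorised if and only if for all $m,n\in\mathbb{N}$, $$u(m,n)=\frac{u(1,m)}{u(1,n-1)}u(m+1,n-1)+(u(m,1)-u(1,m))-(u(n,1)-u(1,n)),$$ $$u(m,0)=u(n,0).$$ In this case a one-point function corresponding to $u$ is given by $f(n)=\prod_{i=1}^n u(1,i-1)$. (2) The following are equivalent. (a) The stationary distribution corresponding to $u$ is factorised in the homogeneous PALRMP with parameter $q$. (b) There exist functions $b:\mathbb{N}_0\to\mathbb{R}_{>0}$ and $c:\mathbb{N}_0\to\mathbb{R}$ with $c(1)=0$ such that for all $m\in\mathbb{N}$ and $n\in\mathbb{N}_0$, $$u(m,n)=b(0)\prod_{k=1}^n\frac{b(m+k-1)}{b(n-k)}+\sum_{\ell=0}^{n-1}\bigg((c(m+\ell)-c(n-\ell))\prod_{k=1}^{\ell}\frac{b(m+k-1)}{b(n-k)}\bigg).$$ In this case, for all $m\in\mathbb{N}$, $u(m,0)=b(0)$, $b(m)=u(1,m)$ and $c(m)=u(m,1)-u(1,m)$, and a one-point function corresponding to $u$ is given by $f(n)=\prod_{i=1}^n b(i-1)$. (c) For all $m,n\in\mathbb{N}$, $$\frac{u(m,n)}{u(1,n)}=\frac{u(n+1,m-1)}{u(1,m-1)},$$ $$u(m,n)-u(n,m)=(u(m,1)-u(1,m))-(u(n,1)-u(1,n)).$$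
   Context: $\mathbb{N}=\{1,2,\dots\}$, $\mathbb{N}_0=\mathbb{N}\cup\{0\}$; empty products are $1$, empty sums are $0$. For $L,N\in\mathbb{N}$, $\Omega_{L,N}=\{\eta=(\eta_1,\dots,\eta_L)\in\mathbb{N}_0^L:\sum_\ell\eta_\ell=N\}$; $\eta_\ell$ is the number of particles at site $\ell$, and sites are arranged on a ring with indices modulo $L$ increasing clockwise. A rate function is $u:\mathbb{N}_0\times\mathbb{N}_0\to\mathbb{R}_{\ge0}$ with $u(m,n)>0$ if $m\ge1$ and $u(0,n)=0$. For sites $k,\ell$, $\eta^{k,\ell}$ is given by $\eta^{k,\ell}_a=\eta_a-\delta_{k,a}+\delta_{\ell,a}$. Homogeneous PALRMP (partially asymmetric long range misanthrope process with all rate parameters equal to $1$) with $q\ge0$ and rate function $u$: the continuous-time Markov chain on $\Omega_{L,N}$ in which, from $\eta$, for every ordered pair of distinct sites $k\ne\ell$ with $\eta_k\ge1$: if all sites strictly between $k$ and $\ell$ going right (clockwise, i.e. $k+1,\dots,\ell-1$ mod $L$) are empty, a particle moves right from $k$ to $\ell$ (giving $\eta^{k,\ell}$) at rate $u(\eta_k,\eta_\ell)$; if all sites strictly between $k$ and $\ell$ going left (i.e. $k-1,\dots,\ell+1$ mod $L$) are empty, a particle moves left from $k$ to $\ell$ (giving $\eta^{k,\ell}$) at rate $q\,u(\eta_k,\eta_\ell)$. If both are possible they count as two transitions and their rates add. The chain is irreducible, so it has a unique stationary distribution. The stationary distribution corresponding to $u$ in the homogeneous PALRMP (with given $q$) is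 factorised if there is $f:\mathbb{N}_0\to\mathbb{R}_{>0}$ such that for all $L,N\in\mathbb{N}$ the stationary distribution on $\Omega_{L,N}$ is $\pi(\eta)=\frac1{Z_{L,N}}\prod_{\ell=1}^L f(\eta_\ell)$, with $Z_{L,N}$ the normalising constant. Any such $f$ is called a one-point function corresponding to $u$ (it is not unique). *)

(* Defs.v *)
From HB Require Import structures.
From mathcomp Require Import all_boot all_order all_algebra.
From mathcomp Require Import reals.
Set Implicit Arguments.
Unset Strict Implicit.
Unset Printing Implicit Defensive.
Import Order.TTheory GRing.Theory Num.Theory.
Local Open Scope ring_scope.

Section Chain.
Variables (R : realType) (T : finType).

(* A continuous-time Markov chain on the finite set [T] is given by its
   off-diagonal jump rates [r]; the diagonal values of [r] are not used. *)
Definition generator (r : T -> T -> R) (x y : T) : R :=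
  if x == y then - \sum_(z | z != x) r x z else r x y.

Definition stationary (r : T -> T -> R) (pi : T -> R) : Prop :=
  [/\ forall x, 0 <= pi x,
      \sum_x pi x = 1
    & forall y, \sum_x pi x * generator r x y = 0].

End Chain.

(* Occupation numbers are at most [N] because they add up to [N]; taking them
   in ['I_N.+1] makes the set of configurations a [finType]. *)
Definition Omega (L N : nat) : Type :=
  {eta : {ffun 'I_L -> 'I_N.+1} | (\sum_l eta l)%N == N}.

Definition occ (L N : nat) (eta : Omega L N) : {ffun 'I_L -> nat} :=
  [ffun l => nat_of_ord (val eta l)].

(* Only used when [k] is occupied, so that the subtraction is exact. *)
Definition move (L : nat) (eta : {ffun 'I_L -> nat}) (k l : 'I_L) :
    {ffun 'I_L -> nat} :=
  [ffun a => (eta a - (k == a) + (l == a))%N].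

(* The number of clockwise steps leading from [k] to [l], in [0, L-1]. *)
Definition cw (L : nat) (k l : 'I_L) : nat := ((l + L - k) %% L)%N.

(* The sites k+1, ..., l-1 (modulo L) are empty. *)
Definition free_right (L : nat) (eta : {ffun 'I_L -> nat}) (k l : 'I_L) : bool :=
  [forall a, (0 < cw k a < cw k l)%N ==> (eta a == 0%N)].

(* The sites k-1, ..., l+1 (modulo L) are empty. *)
Definition free_left (L : nat) (eta : {ffun 'I_L -> nat}) (k l : 'I_L) : bool :=
  [forall a, (0 < cw a k < cw l k)%N ==> (eta a == 0%N)].

Section Palrmp.
Variable R : realType.
Implicit Types (q : R) (u : nat -> nat -> R) (f b c : nat -> R).

Definition rate_function u : Prop :=
  (forall m n, (0 < m)%N -> 0 < u m n) /\ (forall n, u 0%N n = 0).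

Definition palrmp_rate q u (L N : nat) (eta zeta : Omega L N) : R :=
  \sum_(k < L) \sum_(l < L | [&& k != l, (0 < occ eta k)%N
                                & occ zeta == move (occ eta) k l])
    ((if free_right (occ eta) k l then u (occ eta k) (occ eta l) else 0) +
     (if free_left (occ eta) k l then q * u (occ eta k) (occ eta l) else 0)).

Definition weight f (L N : nat) (eta : Omega L N) : R :=
  \prod_(l < L) f (occ eta l).

Definition partition_function f (L N : nat) : R :=
  \sum_(eta : Omega L N) weight f eta.

Definition product_law f (L N : nat) (eta : Omega L N) : R :=
  weight f eta / partition_function f L N.

Definition one_point_function q u f : Prop :=
  (forall n, 0 < f n) /\
  (forall L N : nat, (0 < L)%N -> (0 < N)%N ->
     stationary (@palrmp_rate q u L N) (@product_law f L N)).

Definition factorised q u : Prop := exists f, one_point_function q u f.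

Definition bc_representation u b c : Prop :=
  [/\ forall n, 0 < b n,
      c 1%N = 0
    & forall m n : nat, (1 <= m)%N ->
      u m n =
        b 0%N * (\prod_(1 <= k < n.+1) (b (m + k - 1)%N / b (n - k)%N)) +
        \sum_(0 <= l < n) ((c (m + l)%N - c (n - l)%N) *
          \prod_(1 <= k < l.+1) (b (m + k - 1)%N / b (n - k)%N))].

End Palrmp.

(* Main.v *)
Require Import Defs.
From HB Require Import structures.
From mathcomp Require Import all_boot all_order all_algebra.
From mathcomp Require Import reals.
From mathcomp Require Import ring lra zify.
Set Implicit Arguments.
Unset Strict Implicit.
Unset Printing Implicit Defensive.
Import Order.TTheory GRing.Theory Num.Theory.
Local Open Scope ring_scope.

(** Fix a product law with weights f and look at the stationarity equation at
    a configuration eta, divided by the weight of eta.  A jump from k to l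
    that ends in eta starts from eta with one particle put back from l to k,
    so it contributes
       V (eta_k, eta_l),   V (m, n) = f(m+1) f(n-1) / (f(m) f(n)) u(m+1, n-1),
    and V (m, 0) = 0; it is possible under the same emptiness condition on the
    sites between k and l as the jump from k to l out of eta.  A pair is free
    on the left exactly if the reversed pair is free on the right, so with
    A = u - V (excess) stationarity at eta becomes (stationaryE)
       sum over k <> l with k+1, ..., l-1 empty of
         A (eta_k, eta_l) + q A (eta_l, eta_k) = 0.

    Necessity.  The configuration (m, n) on two sites gives
    A (m, n) = - A (n, m), because 1 + q <> 0.  The summand is then
    (1 - q) A (eta_k, eta_l), and as q <> 1 three sites carrying (m, n, 0) and
    (m, n, 1) give A (m, 0) = A (n, 0) and A (m, n) = A (m, 1) - A (n, 1).
    The former reads u (m, 0) = u (1, 0), and together with antisymmetry it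
    makes f(n+1) / f(n) proportional to u (1, n); the latter is then the
    recursion in part (1) (one_point_recursion).

    Sufficiency.  The recursion expresses u (m, n) through u (m+1, n-1).
    Composing it with itself at the mirror image (n-1, m+1) shows that
    u (m, n) - u (n, m) = c (m) - c (n) propagates from (m+1, n-1) to (m, n),
    and it is trivial near the diagonal (recursion_antisym).  This says that
    V (m, n) = u (n, m): time reversal turns the right-moving dynamics into
    the left-moving one.  Then A (m, n) = o(n) h(m) - o(m) h(n), where o is the
    indicator of being occupied, and the sum vanishes because a site sees as
    many nearest occupied sites clockwise as anticlockwise: one, or none if
    all the other sites are empty (net_flow_eq0).

    The forms (b) and (c) of the recursion are algebra: (b) is the recursion
    iterated down to u (m, 0) (bc_representationE), where antisymmetry forces
    b = u (1, .), and (c) combines it with antisymmetry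
    (recursion_symmetricE). *)

(** * Jumps on the ring *)

Section Moves.
Variable L : nat.
Implicit Types (e : {ffun 'I_L -> nat}) (k l : 'I_L).

Lemma cwE k l : cw k l = if (k <= l)%N then (l - k)%N else (l + L - k)%N.
Proof.
rewrite /cw; have lk := ltn_ord k; have ll := ltn_ord l.
case: leqP => kl.
  by rewrite -addnBAC // modnDr modn_small //; lia.
by rewrite modn_small //; lia.
Qed.

Lemma cw_id k : cw k k = 0%N.
Proof. by rewrite cwE leqnn subnn. Qed.

Lemma cw_gt0 k l : (0 < cw k l)%N = (l != k).
Proof.
rewrite cwE -val_eqE /=; have [kL lL] := (ltn_ord k, ltn_ord l).
by case: (leqP k l); lia.
Qed.

Lemma cw_injr k : injective (cw k).
Proof.
move=> l l'; rewrite !cwE => H; apply: val_inj => /=; move: H.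
have [[lL l'L] kL] := (ltn_ord l, ltn_ord l', ltn_ord k).
by case: (leqP k l); case: (leqP k l'); lia.
Qed.

Lemma cw_injl l : injective (fun k => cw k l).
Proof.
move=> k k'; rewrite /= !cwE => H; apply: val_inj => /=; move: H.
have [[kL k'L] lL] := (ltn_ord k, ltn_ord k', ltn_ord l).
by case: (leqP k l); case: (leqP k' l); lia.
Qed.

Lemma cw_between k l a :
  (0 < cw a k < cw l k)%N = (0 < cw l a < cw l k)%N.
Proof.
rewrite !cwE; have [[kL aL] lL] := (ltn_ord k, ltn_ord a, ltn_ord l).
by case: (leqP a k); case: (leqP l a); case: (leqP l k); lia.
Qed.

(** Travelling left from k to l crosses the same sites as travelling right
    from l to k; this lets everything be expressed by [free_right]. *)
Lemma free_leftE e k l : free_left e k l = free_right e l k.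
Proof. by apply: eq_forallb => a; rewrite cw_between. Qed.

Lemma move_from e k l : k != l -> move e k l k = (e k).-1.
Proof. by move=> kl; rewrite ffunE eqxx eq_sym (negbTE kl) addn0 subn1. Qed.

Lemma move_to e k l : k != l -> move e k l l = (e l).+1.
Proof. by move=> kl; rewrite ffunE eqxx (negbTE kl) subn0 addn1. Qed.

Lemma move_out e k l a : a != k -> a != l -> move e k l a = e a.
Proof.
by rewrite ffunE ![a == _]eq_sym => /negbTE-> /negbTE->; rewrite subn0 addn0.
Qed.

Lemma move_rev_imp e e' k l : k != l ->
  (0 < e k)%N && (e' == move e k l) -> (0 < e' l)%N && (e == move e' l k).
Proof.
move=> kl /andP[ek /eqP ->]; rewrite ffunE eqxx (negbTE kl) addn1 /=.
apply/eqP/ffunP => a; rewrite !ffunE.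
case: (eqVneq k a) => [ka|ka]; case: (eqVneq l a) => [la|la] /=.
- by rewrite ka la eqxx in kl.
- by rewrite -ka; lia.
- by lia.
- by lia.
Qed.

(** Particle moves are reversible, which turns a sum over the predecessors of
    a configuration into a sum over ordered pairs of sites. *)
Lemma move_rev e e' k l : k != l ->
  (0 < e k)%N && (e' == move e k l) = (0 < e' l)%N && (e == move e' l k).
Proof.
by move=> kl; apply/idP/idP; apply: move_rev_imp; rewrite // eq_sym.
Qed.

Lemma sum_move e k l : k != l -> (0 < e k)%N ->
  (\sum_a move e k l a = \sum_a e a)%N.
Proof.
move=> kl ek; rewrite (bigD1 k) // (bigD1 l) /=; last by rewrite eq_sym.
rewrite [RHS](bigD1 k) // [in RHS](bigD1 l) /=; last by rewrite eq_sym.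
rewrite !addnA move_from // move_to //; congr addn; first by lia.
by apply: eq_bigr => a /andP[ak al]; rewrite move_out.
Qed.

(** Hence a jump between k and l does not change whether k and l see each
    other. *)
Lemma eq_free_right e e' k l :
  (forall a, a != k -> a != l -> e a = e' a) ->
  free_right e k l = free_right e' k l.
Proof.
move=> ee'; apply: eq_forallb => a.
case: (eqVneq a k) => [->|ak]; first by rewrite cw_id.
by case: (eqVneq a l) => [->|al]; [rewrite ltnn andbF|rewrite ee'].
Qed.

End Moves.

(** * Configurations with a given number of particles *)

Section Occ.
Variables L N : nat.

Lemma occ_inj : injective (@occ L N).
Proof.
move=> x y /ffunP xy; apply: val_inj; apply/ffunP => l; apply: val_inj.
by have := xy l; rewrite !ffunE.
Qed.

Lemma sum_occ (x : Omega L N) : (\sum_l occ x l)%N = N.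
Proof.
apply: etrans (eqP (valP x)); apply: eq_bigr => l _; exact: ffunE.
Qed.

Lemma occ_surj (e : {ffun 'I_L -> nat}) :
  (\sum_l e l)%N = N -> exists x : Omega L N, occ x = e.
Proof.
move=> eN; have le l : (e l < N.+1)%N.
  by rewrite ltnS -eN (bigD1 l) //= leq_addr.
have sN : (\sum_l [ffun l => Ordinal (le l)] l)%N == N.
  by rewrite -[X in _ == X]eN; apply/eqP/eq_bigr => l _; rewrite ffunE.
pose x : Omega L N := exist _ [ffun l => Ordinal (le l)] sN.
by exists x; apply/ffunP => l; rewrite !ffunE.
Qed.

End Occ.

(** * Stationarity of a product law *)

Section Balance.
Variable R : realType.
Implicit Types (q : R) (u : nat -> nat -> R) (f b c : nat -> R).

(** The rate of entering a configuration by a jump from a site that holds m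
    particles afterwards to a site that holds n particles afterwards, weighted
    by the probability of the preceding configuration relative to the present
    one. *)
Definition backflow u f (m n : nat) : R :=
  if n is n'.+1 then f m.+1 * f n' / (f m * f n) * u m.+1 n' else 0.

Definition excess u f (m n : nat) : R := u m n - backflow u f m n.

Definition jump_rate q u L (e : {ffun 'I_L -> nat}) (k l : 'I_L) : R :=
  (if free_right e k l then u (e k) (e l) else 0) +
  (if free_left e k l then q * u (e k) (e l) else 0).

Lemma sum_occ_eq L N (e : {ffun 'I_L -> nat}) (F : Omega L N -> R) x :
  occ x = e -> \sum_(z | occ z == e) F z = F x.
Proof.
move=> <-; rewrite (eq_bigl (pred1 x)) ?big_pred1_eq // => z /=.
exact: (inj_eq (@occ_inj L N)).
Qed.

Lemma move_occ L N (x : Omega L N) (k l : 'I_L) : k != l ->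
  (0 < occ x k)%N -> exists z : Omega L N, occ z = move (occ x) k l.
Proof. by move=> kl xk; apply: occ_surj; rewrite sum_move ?sum_occ. Qed.

Lemma palrmp_rate_diag q u L N (x : Omega L N) : palrmp_rate q u x x = 0.
Proof.
rewrite /palrmp_rate big1 // => k _; rewrite big1 // => l /and3P[kl xk /eqP].
by move=> /ffunP/(_ l); rewrite move_to // => /n_Sn.
Qed.

Lemma outflow q u L N (x : Omega L N) :
  \sum_z palrmp_rate q u x z =
  \sum_k \sum_(l | (l != k) && (0 < occ x k)%N) jump_rate q u (occ x) k l.
Proof.
rewrite exchange_big; apply: eq_bigr => k _ /=.
rewrite (exchange_big_dep (fun l => (l != k) && (0 < occ x k)%N)) /=; last first.
  by move=> z l _ /and3P[kl xk _]; rewrite eq_sym kl.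
apply: eq_bigr => l /andP[lk xk]; have kl : k != l by rewrite eq_sym.
have [z zE] := move_occ kl xk.
rewrite (eq_bigl (fun z => occ z == move (occ x) k l)) => [|z'].
  exact: (sum_occ_eq _ zE).
by rewrite kl xk.
Qed.

Lemma weight_move f L N (x y : Omega L N) k l : (forall n, 0 < f n) ->
  k != l -> (0 < occ y l)%N -> occ x = move (occ y) l k ->
  weight f x = weight f y *
    (f (occ y k).+1 * f (occ y l).-1 / (f (occ y k) * f (occ y l))).
Proof.
move=> f0 kl yl xE; have fn0 n : f n != 0 by rewrite gt_eqF.
rewrite /weight (bigD1 k) // (bigD1 l) /=; last by rewrite eq_sym.
rewrite [in RHS](bigD1 k) // [in RHS](bigD1 l) /=; last by rewrite eq_sym.
have -> : \prod_(i | (i != k) && (i != l)) f (occ x i) =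
          \prod_(i | (i != k) && (i != l)) f (occ y i).
  by apply: eq_bigr => a /andP[ak al]; rewrite xE move_out.
rewrite xE move_from 1?eq_sym // move_to 1?eq_sym //.
have := fn0 (occ y k); have := fn0 (occ y l).
by move=> ? ?; field; apply/andP.
Qed.

Lemma inflow q u f L N (y : Omega L N) : (forall n, 0 < f n) ->
  \sum_x weight f x * palrmp_rate q u x y =
  weight f y * \sum_k \sum_(l | l != k)
    ((if free_right (occ y) k l then backflow u f (occ y k) (occ y l) else 0) +
     (if free_left (occ y) k l
      then q * backflow u f (occ y k) (occ y l) else 0)).
Proof.
move=> f0.
under eq_bigr do rewrite big_distrr /=.
rewrite exchange_big mulr_sumr; apply: eq_bigr => k _ /=.
under eq_bigr do rewrite big_distrr /=.
rewrite (exchange_big_dep (fun l => l != k)) /=; last first.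
  by move=> x l _ /and3P[kl _ _]; rewrite eq_sym.
rewrite mulr_sumr; apply: eq_bigr => l lk; have kl : k != l by rewrite eq_sym.
rewrite (eq_bigl (fun x => (0 < occ y l)%N && (occ x == move (occ y) l k))).
  case yl: (occ y l) => [|n] /=.
    by rewrite big_pred0_eq mulr0 !if_same addr0 mulr0.
  have yl0 : (0 < occ y l)%N by rewrite yl.
  have [x xE] := move_occ lk yl0.
  rewrite (sum_occ_eq _ xE) (weight_move f0 kl yl0 xE) -mulrA; congr (_ * _).
  have same a : a != k -> a != l -> occ x a = occ y a.
    by move=> ak al; rewrite xE move_out.
  rewrite !free_leftE (eq_free_right same) (@eq_free_right _ _ (occ y) l k);
    last by move=> a al ak; apply: same.
  rewrite xE move_from // move_to //.
  rewrite yl /=.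
  by case: ifP; case: ifP => _ _; rewrite ?addr0 ?add0r ?mulr0 //; ring.
by move=> x; rewrite kl; apply: move_rev.
Qed.

(** Without sites there would be no configuration of N > 0 particles. *)
Lemma partition_function_gt0 f L N : (forall n, 0 < f n) -> (0 < L)%N ->
  0 < partition_function f L N.
Proof.
case: L => // L f0 _.
have w0 (x : Omega L.+1 N) : 0 < weight f x by apply: prodr_gt0.
have [x _] : exists x : Omega L.+1 N,
    occ x = [ffun i => if i == ord0 then N else 0%N].
  apply: occ_surj; rewrite (bigD1 ord0) //= ffunE eqxx big1 ?addn0 // => i.
  by rewrite ffunE => /negbTE->.
rewrite /partition_function (bigD1 x) //= ltr_pwDl //.
by apply: sumr_ge0 => z _; apply: ltW.
Qed.

(** The flow out of a configuration minus the flow into it, relative to its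
    weight; left jumps from k to l are recorded at the ordered pair (l, k). *)
Definition net_flow q u f L (e : {ffun 'I_L -> nat}) : R :=
  \sum_k \sum_(l | (l != k) && free_right e k l)
    (excess u f (e k) (e l) + q * excess u f (e l) (e k)).

Lemma net_flowE q u f L (e : {ffun 'I_L -> nat}) : (forall n, u 0%N n = 0) ->
  \sum_k \sum_(l | (l != k) && (0 < e k)%N) jump_rate q u e k l -
  \sum_k \sum_(l | l != k)
    ((if free_right e k l then backflow u f (e k) (e l) else 0) +
     (if free_left e k l then q * backflow u f (e k) (e l) else 0)) =
  net_flow q u f e.
Proof.
move=> u0; rewrite -sumrB.
transitivity (\sum_k \sum_(l | l != k)
    ((if free_right e k l then excess u f (e k) (e l) else 0) +
     (if free_right e l k then q * excess u f (e k) (e l) else 0))).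
  apply: eq_bigr => k _; rewrite big_mkcondr -sumrB; apply: eq_bigr => l _.
  rewrite /jump_rate /excess !free_leftE.
  (* An empty site k contributes no outflow, in accordance with u (0, n) = 0. *)
  case: posnP => [->|_]; rewrite ?u0;
    by case: ifP; case: ifP => _ _; ring.
under eq_bigr do rewrite big_split /=.
rewrite big_split /= [X in _ + X](exchange_big_dep xpredT) //= -big_split /=.
apply: eq_bigr => k _; under [X in _ + X]eq_bigl do rewrite eq_sym.
rewrite -big_split [RHS]big_mkcondr /=; apply: eq_bigr => l _.
by case: ifP; rewrite ?addr0.
Qed.

(** Each equation of the stationarity system is the net flow at one
    configuration times a nonzero factor. *)
Lemma stationaryE q u f L N : (forall n, u 0%N n = 0) ->
  (forall n, 0 < f n) -> (0 < L)%N ->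
  stationary (@palrmp_rate R q u L N) (@product_law R f L N) <->
  forall y : Omega L N, net_flow q u f (occ y) = 0.
Proof.
move=> u0 f0 L0; have Z0 := partition_function_gt0 N f0 L0.
have w0 (x : Omega L N) : 0 < weight f x by apply: prodr_gt0.
have flow (y : Omega L N) :
    \sum_x product_law f x * generator (@palrmp_rate R q u L N) x y =
    - (weight f y / partition_function f L N) * net_flow q u f (occ y).
  transitivity ((\sum_x weight f x * palrmp_rate q u x y -
    weight f y * \sum_z palrmp_rate q u y z) / partition_function f L N).
    rewrite (bigD1 y) //= [in RHS](bigD1 y) //= palrmp_rate_diag.
    rewrite [\sum_z _](bigD1 y) //= palrmp_rate_diag mulr0 !add0r.
    rewrite mulrBl mulr_suml addrC /generator eqxx; congr (_ + _).
      apply: eq_bigr => x xy; rewrite (negbTE xy) /product_law.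
      by rewrite mulrAC.
    by rewrite mulrN /product_law mulrAC.
  by rewrite inflow // outflow // -mulrBr mulrAC -(net_flowE _ _ _ u0); ring.
split=> [[_ _ st] y|st].
  have /eqP := st y; rewrite flow mulf_eq0 oppr_eq0 gt_eqF ?divr_gt0 //=.
  by move/eqP.
split=> [x||y].
- by rewrite /product_law divr_ge0 ?ltW.
- by rewrite /product_law -mulr_suml mulfV ?gt_eqF.
- by rewrite flow st mulr0.
Qed.

(** * Nearest occupied sites *)

(** With d the distance from k in one direction of the ring, the sum counts
    the occupied sites other than k that k sees in that direction.  Only a
    minimiser of d among them qualifies, and d is injective. *)
Lemma sum_nearest_occupied (T : finType) (d e : T -> nat) k : injective d ->
  (forall a, (0 < d a)%N = (a != k)) ->
  \sum_(l | (l != k) && [forall a, (0 < d a < d l)%N ==> (e a == 0%N)])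
    (0 < e l)%N%:R = [exists l, (l != k) && (0 < e l)%N]%:R :> R.
Proof.
move=> d_inj d0; case: existsP => [[l0 Pl0]|nP]; last first.
  rewrite big1 // => l /andP[lk _]; case: posnP => // el.
  by case: nP; exists l; rewrite lk.
have [l /andP[lk el] lmin] :=
  @arg_minnP T l0 (fun l => (l != k) && (0 < e l)%N) d Pl0.
rewrite (bigD1 l) /= ?el; last first.
  rewrite lk; apply/forallP => a; apply/implyP; rewrite d0 => /andP[ak al].
  by apply: contraTT al; rewrite -lt0n -leqNgt => ea; rewrite lmin ?ak.
rewrite big1 ?addr0 // => l' /andP[/andP[l'k /forallP/(_ l) free] l'l].
case: posnP => // el'; move: free.
rewrite d0 lk (gtn_eqF el) implybF -leqNgt leq_eqVlt ltnNge lmin ?l'k //.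
by rewrite orbF (inj_eq d_inj) (negbTE l'l).
Qed.

Lemma sum_next_occupied L (e : {ffun 'I_L -> nat}) k :
  \sum_(l | (l != k) && free_right e k l) (0 < e l)%N%:R =
  [exists l, (l != k) && (0 < e l)%N]%:R :> R.
Proof.
exact: (sum_nearest_occupied _ (@cw_injr L k) (cw_gt0 k)).
Qed.

Lemma sum_prev_occupied L (e : {ffun 'I_L -> nat}) l :
  \sum_(k | (k != l) && free_right e k l) (0 < e k)%N%:R =
  [exists k, (k != l) && (0 < e k)%N]%:R :> R.
Proof.
under eq_bigl do rewrite -free_leftE.
by apply: sum_nearest_occupied (@cw_injl L l) _ => a; rewrite cw_gt0 eq_sym.
Qed.

(** Up to the factor 1 - q, every site k contributes h (eta_k) once for
    each occupied site it sees clockwise and - h (eta_k) once for each one it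
    sees anticlockwise.  Both numbers are 1 if some other site is occupied and
    0 otherwise. *)
Lemma net_flow_eq0 q u f h L (e : {ffun 'I_L -> nat}) :
  (forall m n, excess u f m n = (0 < n)%N%:R * h m - (0 < m)%N%:R * h n) ->
  net_flow q u f e = 0.
Proof.
move=> exE; rewrite /net_flow.
transitivity ((1 - q) * \sum_k \sum_(l | (l != k) && free_right e k l)
   ((0 < e l)%N%:R * h (e k) - (0 < e k)%N%:R * h (e l))).
  rewrite mulr_sumr; apply: eq_bigr => k _; rewrite mulr_sumr.
  by apply: eq_bigr => l _; rewrite !exE; ring.
apply/eqP; rewrite mulf_eq0; apply/orP; right; apply/eqP.
under eq_bigr do rewrite sumrB.
rewrite sumrB [X in _ - X](exchange_big_dep xpredT) //= -sumrB big1 // => k _.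
rewrite -!mulr_suml sum_next_occupied.
under eq_bigl do rewrite eq_sym.
by rewrite sum_prev_occupied subrr.
Qed.

(** * Net flow on two and three sites *)

Definition config (s : seq nat) : {ffun 'I_(size s) -> nat} :=
  [ffun i : 'I_(size s) => nth 0%N s i].

(** An iterated conjunction can be expanded over the sites of a concrete
    ring. *)
Lemma free_rightE L (e : {ffun 'I_L -> nat}) k l :
  free_right e k l =
  \big[andb/true]_(a < L) ((0 < cw k a < cw k l)%N ==> (e a == 0%N)).
Proof. by rewrite big_andE; apply: eq_forallb. Qed.

Lemma net_flow2 q u f m n :
  net_flow q u f (config [:: m; n]) =
  (1 + q) * (excess u f m n + excess u f n m).
Proof.
rewrite /net_flow; under eq_bigr do rewrite big_mkcond.
rewrite !big_ord_recl !big_ord0 !free_rightE !big_ord_recl !big_ord0 /= !ffunE /=.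
by ring.
Qed.

(** On three sites neighbours always see each other clockwise; an empty site
    in addition lets its two neighbours see each other through it. *)
Lemma net_flow3 q u f m n p :
  let W m n := excess u f m n + q * excess u f n m in
  net_flow q u f (config [:: m; n; p]) =
  W m n + W n p + W p m +
  (n == 0%N)%:R * W m p + (p == 0%N)%:R * W n m + (m == 0%N)%:R * W p n.
Proof.
rewrite /net_flow; under eq_bigr do rewrite big_mkcond.
rewrite !big_ord_recl !big_ord0 !free_rightE !big_ord_recl !big_ord0 /= !ffunE /=.
rewrite !andbT; case: (m == _); case: (n == _); case: (p == _) => /=; ring.
Qed.

End Balance.

(** * The recursion for the rate function *)

Section Algebra.
Variable R : realType.
Implicit Types (q : R) (u : nat -> nat -> R) (f b c : nat -> R).

(** All the characterisations of factorised rates are forms of this recursion,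
    which fixes u on the antidiagonal m + n = s starting from u (s, 0). *)
Definition exchange_recursion u b c :=
  (forall m, (0 < m)%N -> u m 0%N = b 0%N) /\
  (forall m n, (0 < m)%N ->
     u m n.+1 = b m / b n * u m.+1 n + c m - c n.+1).

(** Write D (m, n) for the claim.  The recursions at (m, n+1) and (n, m+1)
    have reciprocal factors b m / b n and b n / b m, so D (m+1, n) implies
    D (m, n+1).  On each antidiagonal this reaches every pair with m <= n from
    the centre, where D (m, m) is void and D (m, m+1) is the recursion with
    factor b m / b m = 1. *)
Lemma recursion_antisym u b c : (forall n, 0 < b n) -> exchange_recursion u b c ->
  forall m n, (0 < m)%N -> (0 < n)%N -> u m n - u n m = c m - c n.
Proof.
move=> b0 [_ rec]; have bn0 n : b n != 0 by rewrite gt_eqF.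
have step m n : (0 < m)%N -> (0 < n)%N ->
    u m.+1 n - u n m.+1 = c m.+1 - c n -> u m n.+1 - u n.+1 m = c m - c n.+1.
  move=> m0 n0; rewrite (rec n) // (rec m) // => E.
  have -> : u m.+1 n = b n / b m * u n.+1 m by lra.
  by field; rewrite !bn0.
have diag d m : (0 < m)%N -> u m (m + d)%N - u (m + d)%N m = c m - c (m + d)%N.
  have [k] := ubnP d; elim: k d m => // k IH [|[|d]] m dk m0.
  - by rewrite addn0 !subrr.
  - by rewrite addn1 rec // mulfV // mul1r; ring.
  - rewrite addnS; apply: step => //; first by rewrite addn_gt0 m0.
    by rewrite -addSnnS; apply: IH => //; rewrite -ltnS ltnW.
move=> m n m0 n0; case/orP: (leq_total m n) => [mn|nm].
  by rewrite -(subnKC mn) diag.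
by apply: oppr_inj; rewrite !opprB -(subnKC nm) diag.
Qed.

(** The recursion at (n, 1) gives u (n, 1) = b n + c n, and antisymmetry gives
    u (n, 1) - u (1, n) = c n. *)
Lemma recursion_normalised u b c : (forall n, 0 < b n) -> exchange_recursion u b c ->
  c 1%N = 0 ->
  (forall n, b n = u 1%N n) /\
  (forall n, (0 < n)%N -> c n = u n 1%N - u 1%N n).
Proof.
move=> b0 bal c1; have anti := recursion_antisym b0 bal; case: bal => u0 rec.
split=> [[|n]|n n0]; first by rewrite u0.
  have := anti n.+1 1%N isT isT; rewrite rec // u0 // mulfVK ?gt_eqF //; lra.
by rewrite anti // c1 subr0.
Qed.

(** Peeling the factor k = 1 off every product and the term l = 0 off the sum
    leaves b m / b n times the same expression at (m+1, n). *)
Lemma bc_sum_recursion b c m n :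
  let S m n := b 0%N * (\prod_(1 <= k < n.+1) (b (m + k - 1)%N / b (n - k)%N)) +
        \sum_(0 <= l < n) ((c (m + l)%N - c (n - l)%N) *
          \prod_(1 <= k < l.+1) (b (m + k - 1)%N / b (n - k)%N)) in
  S m n.+1 = b m / b n * S m.+1 n + c m - c n.+1.
Proof.
have shift l : \prod_(1 <= k < l.+2) (b (m + k - 1)%N / b (n.+1 - k)%N) =
    b m / b n * \prod_(1 <= k < l.+1) (b (m.+1 + k - 1)%N / b (n - k)%N).
  rewrite big_ltn // big_add1 /= addnK subSS subn0; congr (_ * _).
  by apply: eq_bigr => k _; rewrite addSnnS subSS.
move=> S; rewrite /S shift [\sum_(0 <= l < n.+1) _]big_ltn //.
rewrite [\prod_(1 <= k < 1) _]big_geq // addn0 subn0.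
rewrite [\sum_(1 <= i < n.+1) _]big_add1 /=.
have -> : \sum_(0 <= i < n) (c (m + i.+1)%N - c (n.+1 - i.+1)%N) *
      \prod_(1 <= k < i.+2) (b (m + k - 1)%N / b (n.+1 - k)%N) =
    b m / b n * \sum_(0 <= l < n) ((c (m.+1 + l)%N - c (n - l)%N) *
      \prod_(1 <= k < l.+1) (b (m.+1 + k - 1)%N / b (n - k)%N)).
  rewrite mulr_sumr; apply: eq_bigr => l _.
  by rewrite shift addSnnS subSS; ring.
by ring.
Qed.

Lemma bc_representationE u b c : bc_representation u b c <->
  [/\ forall n, 0 < b n, c 1%N = 0 & exchange_recursion u b c].
Proof.
split=> -[b0 c1 H]; split=> //.
  split=> [m m0|m n m0]; first by rewrite H // !big_geq // mulr1 addr0.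
  by rewrite H // bc_sum_recursion -H.
case: H => u0 rec m n; elim: n m => [|n IH] m m0.
  by rewrite u0 // !big_geq // mulr1 addr0.
by rewrite rec // IH // -bc_sum_recursion.
Qed.

(** For m >= 1 this is the only possible value of c (m) in part (2b). *)
Definition asym u m := u m 1%N - u 1%N m.

(** * Factorised rates *)

Section Rate.
Variables (u : nat -> nat -> R) (hu : rate_function u).

Lemma u1_gt0 n : 0 < u 1%N n. Proof. by case: hu => h _; apply: h. Qed.
Lemma u1_neq0 n : u 1%N n != 0. Proof. by rewrite gt_eqF ?u1_gt0. Qed.

(** With f(n+1) / f(n) = u (1, n) the recursion and antisymmetry give
    [backflow u f m n = u n m], so the excess is u (m, n) - u (n, m). *)
Lemma recursion_one_point q f : exchange_recursion u (u 1%N) (asym u) ->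
  (forall n, 0 < f n) -> (forall n, f n.+1 = f n * u 1%N n) ->
  one_point_function q u f.
Proof.
move=> bal f0 fS; split=> // L N L0 _; have [up u00] := hu.
have anti := recursion_antisym u1_gt0 bal; case: bal => u0 rec.
have fn0 n : f n != 0 by rewrite gt_eqF.
have back m n : backflow u f m n = u n m.
  case: n => [|n]; first by rewrite u00.
  rewrite /= fS fS.
  have -> : f m * u 1%N m * f n / (f m * (f n * u 1%N n)) = u 1%N m / u 1%N n.
    by field; rewrite !fn0 u1_neq0.
  case: m => [|m]; first by rewrite mulfVK ?u1_neq0 // u0.
  by have := anti m.+1 n.+1 isT isT; rewrite rec //; lra.
apply/stationaryE => // y.
(* Between an occupied and an empty site the excess is u (m, 0) = u (1, 0),
   whence the value of h at 0. *)
apply: (@net_flow_eq0 _ q u f (fun m => if m is 0%N then - u 1%N 0%N else asym u m)).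
move=> m n; rewrite /excess back; case: m n => [|m] [|n] /=.
- by rewrite !subrr.
- by rewrite u00 u0 //; ring.
- by rewrite u00 u0 //; ring.
- by rewrite anti // /asym; ring.
Qed.

(** Two sites make the excess antisymmetric, three sites make it a difference
    of a function of m and a function of n; see the argument at the top. *)
Lemma one_point_recursion q f : 0 <= q -> q != 1 ->
  one_point_function q u f -> exchange_recursion u (u 1%N) (asym u).
Proof.
move=> q0 q1 [f0 st]; have [up u00] := hu.
have fn0 n : f n != 0 by rewrite gt_eqF.
have flow0 s : (0 < size s)%N -> (0 < \sum_l config s l)%N ->
    net_flow q u f (config s) = 0.
  move=> L0 N0; have [y yE] := @occ_surj (size s) _ (config s) erefl.
  rewrite -yE; exact: (proj1 (stationaryE q _ u00 f0 L0) (st _ _ L0 N0)).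
have anti m n : (0 < m)%N -> excess u f n m = - excess u f m n.
  move=> m0; have := flow0 [:: m; n] isT; rewrite net_flow2.
  rewrite big_ord_recl ffunE addn_gt0 m0 => /(_ isT)/eqP.
  rewrite mulf_eq0 gt_eqF ?ltr_wpDr //= addrC addr_eq0.
  by move/eqP.
have cyclic m n p : (0 < m)%N -> (0 < n)%N ->
    excess u f m n + excess u f n p + excess u f p m +
    (p == 0%N)%:R * excess u f n m = 0.
  move=> m0 n0; have := flow0 [:: m; n; p] isT; rewrite net_flow3.
  rewrite big_ord_recl ffunE addn_gt0 m0 => /(_ isT).
  rewrite (gtn_eqF m0) (gtn_eqF n0) !mul0r !addr0.
  rewrite (anti m n m0) (anti n p n0) (anti m p m0) => E.
  have : (1 - q) * (excess u f m n + excess u f n p - excess u f m p +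
    (p == 0%N)%:R * - excess u f m n) = 0 by rewrite -E; ring.
  by move/eqP; rewrite mulf_eq0 subr_eq0 eq_sym (negbTE q1) /= => /eqP.
have ex0 m : excess u f m 0 = u m 0%N by rewrite /excess subr0.
(* Three sites carrying (1, m, 0). *)
have u0 m : (0 < m)%N -> u m 0%N = u 1%N 0%N.
  move=> m0; have := cyclic 1%N m 0%N isT m0.
  by rewrite !ex0 (anti 1%N m) // (anti 1%N 0%N) // !ex0 /=; lra.
(* The configuration with n+1 particles on one of two sites. *)
have f_ratio n : u 1%N n = u 1%N 0%N * (f 0%N * f n.+1 / (f 1%N * f n)).
  have := anti n.+1 0%N isT; rewrite ex0 u0 // /excess u00 /= => E.
  have {E} -> : u 1%N 0%N = f 1%N * f n / (f 0%N * f n.+1) * u 1%N n by lra.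
  by field; rewrite !fn0.
have back m n : backflow u f m n.+1 = u 1%N m / u 1%N n * u m.+1 n.
  rewrite /= (f_ratio m) (f_ratio n); congr (_ * _).
  by field; rewrite !fn0 gt_eqF ?up.
have ex1 m : (0 < m)%N -> excess u f m 1 = asym u m.
  by move=> m0; rewrite /excess back u0 // mulfVK // gt_eqF ?up.
(* Three sites carrying (m, n+1, 1). *)
split=> // m n m0; have := cyclic m n.+1 1%N m0 isT.
rewrite mul0r addr0 (anti m) // !ex1 // {1}/excess back; lra.
Qed.

Lemma recursion_normalisedE : exchange_recursion u (u 1%N) (asym u) <->
  (forall m n : nat, (1 <= m)%N -> (1 <= n)%N ->
         u m n = u 1%N m / u 1%N (n - 1)%N * u (m + 1)%N (n - 1)%N
                 + (u m 1%N - u 1%N m) - (u n 1%N - u 1%N n)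
         /\ u m 0%N = u n 0%N).
Proof.
split=> [[u0 rec] m [//|n] m0 n0|H].
  by rewrite subn1 addn1 rec // !u0.
split=> [m m0|m n m0]; first by have [] := H m 1%N m0 isT.
by have [-> _] := H m n.+1 m0 isT; rewrite subn1 addn1.
Qed.

(** The first identity in (c) is the recursion at (n, m) with u (n, m)
    eliminated by the second one, which is antisymmetry; its case m = 1 says
    that u (n+1, 0) = u (1, 0). *)
Lemma recursion_symmetricE : exchange_recursion u (u 1%N) (asym u) <->
  (forall m n : nat, (1 <= m)%N -> (1 <= n)%N ->
         u m n / u 1%N n = u (n + 1)%N (m - 1)%N / u 1%N (m - 1)%N
         /\ u m n - u n m = (u m 1%N - u 1%N m) - (u n 1%N - u 1%N n)).
Proof.
split=> [bal [//|m] n m0 n0|H].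
  have E := recursion_antisym u1_gt0 bal m0 n0; split=> //.
  have [_ rec] := bal; move: E; rewrite subn1 addn1 /= (rec n) // /asym => E.
  have -> : u m.+1 n = u 1%N n / u 1%N m * u n.+1 m by lra.
  by field; rewrite !u1_neq0.
split=> [[//|[//|m]] _|m n m0].
  have [] := H 1%N m.+1 isT isT; rewrite mulfV ?u1_neq0 // addn1 subn1 /= => E _.
  by rewrite -(divfK (u1_neq0 0%N) (u m.+2 0%N)) -E mul1r.
have [E _] := H n.+1 m isT m0; have [_ F] := H m n.+1 m0 isT.
move: E; rewrite addn1 subn1 /= => E.
have {E} : u n.+1 m = u 1%N m / u 1%N n * u m.+1 n.
  by rewrite -[LHS](divfK (u1_neq0 m)) E mulrC mulrCA mulrC.
by move: F; rewrite /asym; lra.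
Qed.

End Rate.
End Algebra.

Theorem theorem3p6 (R : realType) (q : R) (u : nat -> nat -> R)
    (hq0 : 0 <= q) (hq1 : q != 1) (hu : rate_function u) :
  (* (1) *)
  ((factorised q u <->
      (forall m n : nat, (1 <= m)%N -> (1 <= n)%N ->
         u m n = u 1%N m / u 1%N (n - 1)%N * u (m + 1)%N (n - 1)%N
                 + (u m 1%N - u 1%N m) - (u n 1%N - u 1%N n)
         /\ u m 0%N = u n 0%N)) /\
   (factorised q u ->
      one_point_function q u
        (fun n => \prod_(1 <= i < n.+1) u 1%N (i - 1)%N))) /\
  (* (2) *)
  [/\ (* (a) <-> (b) *)
      factorised q u <-> (exists b c : nat -> R, bc_representation u b c),
      (* (a) <-> (c) *)
      factorised q u <->
      (forall m n : nat, (1 <= m)%N -> (1 <= n)%N ->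
         u m n / u 1%N n = u (n + 1)%N (m - 1)%N / u 1%N (m - 1)%N
         /\ u m n - u n m = (u m 1%N - u 1%N m) - (u n 1%N - u 1%N n))
    & (* the identification of b, c and a one-point function in (b) *)
      forall b c : nat -> R, bc_representation u b c ->
        (forall m : nat, (1 <= m)%N ->
           [/\ u m 0%N = b 0%N, b m = u 1%N m & c m = u m 1%N - u 1%N m]) /\
        one_point_function q u
          (fun n => \prod_(1 <= i < n.+1) b (i - 1)%N)].
Proof.
have u1_gt0 := u1_gt0 hu.
have one_point b : (forall n, b n = u 1%N n) -> exchange_recursion u (u 1%N) (asym u) ->
    one_point_function q u (fun n => \prod_(1 <= i < n.+1) b (i - 1)%N).
  move=> bE bal; apply: recursion_one_point => // n.
    by apply: prodr_gt0 => i _; rewrite bE.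
  by rewrite big_nat_recr //= subn1 bE.
have factE : factorised q u <-> exchange_recursion u (u 1%N) (asym u).
  split=> [[f]|bal]; first exact: one_point_recursion.
  by exists (fun n => \prod_(1 <= i < n.+1) u 1%N (i - 1)%N); apply: one_point.
have bcE b c : bc_representation u b c ->
    [/\ forall n, b n = u 1%N n, forall n, (0 < n)%N -> c n = asym u n
      & exchange_recursion u (u 1%N) (asym u)].
  move=> /bc_representationE[b0 c1 bal].
  have [bE cE] := recursion_normalised b0 bal c1; split=> //.
  have [u0 rec] := bal; split=> [m m0|m n m0]; first by rewrite u0 // bE.
  by rewrite rec // !bE !cE.
split; [split|split].
- exact: iff_trans factE (recursion_normalisedE u).
- by move/factE; apply: one_point.
- apply: iff_trans factE _; split=> [bal|[b [c /bcE[]]] //].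
  exists (u 1%N), (asym u); apply/bc_representationE; split=> //.
  exact: subrr.
- exact: iff_trans factE (recursion_symmetricE hu).
- move=> b c bc; have [bE cE bal] := bcE b c bc; split; last exact: one_point.
  by move=> m m0; rewrite !bE cE //; split=> //; case: bal => ->.
Qed.
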